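(* Let $F\in\mathbb{F}_m[w_0,\ldots,w_s]$, where $\mathbb{F}_m$ is the last field of a radical tower over $\mathbb{C}(x)$, and consider the ODE \[F(x,y,y',\ldots,y^{(s)})=0\] for an unknown function $y=y(x)$. Let $r(z)$ be a non-constant rational function, and let $\overline{a}(x)\in \mathbb{F}_{m}^{\ell}$ be the tuple of the non-rational coefficients of $F$ with respect to the variables $\overline{w}=(w_0,\ldots,w_s)$ (i.e. those coefficients that are not in $\mathbb{C}(x)$), taken in any order. Let \[G(r(z),Y(z),\ldots,Y^{(s)}(z))=0,\qquad Y(z)=y(r(z)),\] be the ODE obtained from $F(x,y,\ldots,y^{(s)})=0$ by the substitution $x=r(z)$. The following are equivalent: \begin{enumerate} \item The transformed equation $G(r(z),Y(z),\ldots,Y^{(s)}(z))=0$ is algebraic. \item All the components of $\overline{a}(r(z))$ are rational. \end{enumerate}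
   Context: A radical tower over $\mathbb{C}(x)$ is a chain of fields $\mathbb{F}_0=\mathbb{C}(x)\subseteq\dots\subseteq\mathbb{F}_{m-1}\subseteq\mathbb{F}_{m}$ with $\mathbb{F}_i=\mathbb{F}_{i-1}(\delta_i)=\mathbb{F}_0(\delta_1,\ldots,\delta_i)$, where $\delta_i^{e_i}=\alpha_i\in\mathbb{F}_{i-1}$ and $e_i\in\mathbb{N}$ is positive. Elements of $\mathbb{F}_m$ are regarded as functions of $x$ after a choice of branches of the radicals, and for $a\in\mathbb{F}_m$ the notation $a(r(z))$ means the composite function of $z$; it is called rational if it is a rational function of $z$, i.e. an element of $\mathbb{C}(z)$. The transformed equation is obtained as follows: replace $x$ by $r(z)$ in the coefficients of $F$, and replace $y^{(j)}(r(z))$ by its expression in terms of the derivatives of $Y$ given by the chain rule, that is, $y(r(z))=Y(z)$ and $y^{(j)}(r(z))=\left(\frac{1}{r'(z)}\frac{d}{dz}\right)^{j}Y(z)$. The result is a polynomial expression in $Y,Y',\ldots,Y^{(s)}$ whose coefficients are functions of $z$. The transformed equation is called algebraic if all these coefficients are rational functions of $z$. *)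

(* Defs.v *)
From HB Require Import structures.
From mathcomp Require Import all_boot all_order all_algebra all_field.
From mathcomp Require Import generic_quotient fraction complex ring mpoly.
From mathcomp Require Import boolp classical_sets functions cardinality reals.
From mathcomp Require Import topology normedtype derive.

Set Implicit Arguments.
Unset Strict Implicit.
Unset Printing Implicit Defensive.

Import GRing.Theory Num.Theory numFieldNormedType.Exports.

Local Open Scope classical_set_scope.
Local Open Scope ring_scope.

(* The regular algebra [R[i]^o] is where the metric topology of the complex
   plane and the complex derivative live. *)
Notation Cplx R := (R[i]^o).
Notation ratfun R := {fraction {poly R[i]}}.

(* Functions are total, so a meromorphic function has junk values at its poles;
   a rational function also has junk values at the zeros of a common factor of
   the numerator and denominator of the chosen representative. The functions
   considered here are algebraic over C(x), hence have finitely many poles, and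
   they are compared up to finite sets. *)
Definition ratval (R : realType) (f : ratfun R) (z : R[i]) : R[i] :=
  (\n_(repr f)).[z] / (\d_(repr f)).[z].

Definition almost_everywhere (R : realType) (D : set (Cplx R))
    (P : R[i] -> Prop) : Prop :=
  finite_set (D `&` [set z | ~ P z]).

Definition almost_eq (R : realType) (D : set (Cplx R)) (f g : R[i] -> R[i]) :
    Prop :=
  almost_everywhere D (fun z => f z = g z).

Definition is_rational (R : realType) (D : set (Cplx R)) (f : R[i] -> R[i]) :
    Prop :=
  exists q : ratfun R, almost_eq D f (ratval q).

Definition complex_domain (R : realType) (D : set (Cplx R)) : Prop :=
  [/\ open D, connected D & D !=set0].

(* [L] is the last field F_m; the tuple [delta] is indexed from 0, so that
   [tnth delta i] is delta_(i+1), with its power in F_i. *)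
Definition tower_field (K : fieldType) (L : fieldExtType K) (delta : seq L)
    (i : nat) : {vspace L} :=
  <<1 & take i delta>>%VS.

Definition radical_tower (K : fieldType) (L : fieldExtType K) (m : nat)
    (delta : m.-tuple L) (e : m.-tuple nat) : Prop :=
  (forall i : 'I_m, (0 < tnth e i)%N /\
     tnth delta i ^+ tnth e i \in tower_field delta i) /\
  tower_field delta m = fullv.

(* A choice of branches of the radicals on the domain [U] amounts to a
   realization of the elements of the tower as meromorphic functions on [U],
   compatible with the field operations and with the usual meaning of the
   elements of C(x). *)
Definition branch_choice (R : realType) (L : fieldExtType (ratfun R))
    (U : set (Cplx R)) (ev : L -> R[i] -> R[i]) : Prop :=
  [/\ forall a : L,
        almost_everywhere U (fun x => derivable (ev a : Cplx R -> Cplx R) x 1),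
      forall f : ratfun R, almost_eq U (ev f%:A) (ratval f),
      forall a b : L, almost_eq U (ev (a + b)) (fun x => ev a x + ev b x)
    & forall a b : L, almost_eq U (ev (a * b)) (fun x => ev a x * ev b x)].

Notation tofrac := (@FracField.tofrac _).

(* The derivation d/dz of the field C(z), by the quotient rule. *)
Definition fracderiv (K : fieldType) (f : {fraction {poly K}}) :
    {fraction {poly K}} :=
  let p := \n_(repr f) in let q := \d_(repr f) in
  tofrac (p^`() * q - p * q^`()) / tofrac (q ^+ 2).

Lemma frac_numden (K : fieldType) (f : {fraction {poly K}}) :
  f = tofrac \n_(repr f) / tofrac \d_(repr f).
Proof.
have dn0 := denom_ratioP (repr f).
apply: (canRL (mulfK _)); first by rewrite tofrac_eq0.
rewrite -{1}[f]reprK; move: (repr f) dn0 => x dn0.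
have tofrac_pi (p : {poly K}) :
  tofrac p = \pi_({fraction {poly K}})%qT (Ratio p 1) by rewrite piE.
have mulr_pi (y z : {ratio {poly K}}) :
  (\pi_({fraction {poly K}}) y * \pi_({fraction {poly K}}) z)%qT =
  \pi_({fraction {poly K}})%qT (FracField.mulf y z) by rewrite piE.
rewrite !tofrac_pi mulr_pi.
apply/eqmodP; rewrite /= FracField.equivfE /FracField.mulf.
by rewrite !numden_Ratio ?mulr1 ?oner_neq0 // mulrC.
Qed.

Lemma fracderivE (K : fieldType) (p q : {poly K}) : q != 0 ->
  fracderiv (tofrac p / tofrac q)
  = tofrac (p^`() * q - p * q^`()) / tofrac (q ^+ 2).
Proof.
move=> q0; rewrite /fracderiv; set f := tofrac p / tofrac q.
have := frac_numden f; rewrite {1}/f.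
have := denom_ratioP (repr f).
move: (\n_(repr f)) (\d_(repr f)) => n d d0 /eqP.
rewrite eqr_div ?tofrac_eq0 // -!tofracM tofrac_eq => /eqP npd.
apply/eqP; rewrite eqr_div ?tofrac_eq0 ?expf_neq0 // -!tofracM tofrac_eq.
have := congr1 (@deriv K) npd; rewrite !derivM => dnpd.
apply/eqP.
have -> : (n^`() * d - n * d^`()) * q ^+ 2
  = (n^`() * q + n * q^`()) * (d * q) - n * q * (q^`() * d + d^`() * q) by ring.
have -> : (p^`() * q - p * q^`()) * d ^+ 2
  = (p^`() * d + p * d^`()) * (d * q) - p * d * (q^`() * d + d^`() * q) by ring.
by rewrite npd dnpd.
Qed.

(* The polynomial [\sum_k b_k 'X^k] over C(z) stands for the linear
   differential expression [\sum_k b_k Y^(k)]; its total derivative is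
   [\sum_k (b_k' Y^(k) + b_k Y^(k+1))]. *)
Definition total_deriv (K : fieldType) (P : {poly {fraction {poly K}}}) :
    {poly {fraction {poly K}}} :=
  map_poly (@fracderiv K) P + P * 'X.

Definition chain_rule (K : fieldType) (r : {fraction {poly K}}) (j : nat) :
    {poly {fraction {poly K}}} :=
  iter j (fun P => (fracderiv r)^-1 *: total_deriv P) 1.

Definition transformed (R : realType) (L : fieldExtType (ratfun R))
    (ev : L -> R[i] -> R[i]) (r : ratfun R) (s : nat) (F : {mpoly L[s.+1]})
    (z : R[i]) : {mpoly R[i][s.+1]} :=
  map_mpoly (fun a : L => ev a (ratval r z)) F \mPo
    [tuple \sum_(k < s.+1) ratval (chain_rule r j)`_k z *: 'X_k | j < s.+1].

(* Main.v *)
Require Import Defs.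
From mathcomp Require Import all_boot all_order all_algebra all_field.
From mathcomp Require Import generic_quotient fraction complex mpoly.
From mathcomp Require Import boolp classical_sets functions cardinality reals.
From mathcomp Require Import topology normedtype derive.

Set Implicit Arguments.
Unset Strict Implicit.
Unset Printing Implicit Defensive.

Import GRing.Theory Num.Theory numFieldNormedType.Exports.

Local Open Scope classical_set_scope.
Local Open Scope ring_scope.

(** Write [P_z] for [F] with its coefficients evaluated at [r(z)].  By the
    chain rule the transformed equation is [P_z] after the linear change of
    variables [w_j = sum_k M_jk Y^(k)], where the matrix [M] has entries in
    C(z).  The entry [M_jk] vanishes for [k > j] and [M_jj] is [(r')^-j], and
    [r'] is nonzero because [r] is not constant; so [M] is invertible over
    C(z).  Composing with the linear substitution [M(z)], or with that of the
    inverse matrix, expresses the coefficients of the transformed equation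
    and those of [P_z] as linear combinations of each other with coefficients
    in C(z), outside a finite set.  Hence the transformed equation is algebraic if and only if all
    coefficients of [P_z] are rational.  The coefficients of [F] which lie in
    C(x) become rational by composition with [r] in any case, so only the
    non-rational ones matter.

    Functions being compared outside finite sets, identities of rational
    functions must be turned into identities of their values: [ratvalD],
    [ratvalM] and [ratvalV] do this for the field operations, and
    [almost_everywhere_ratval] allows the substitution [x = r(z)], because a
    nonconstant rational function has finite fibres.  The linear algebra is
    [comp_linsubst] and [chain_mx_unit], and [fracderiv_eq0] is the fact that
    only constants have derivative zero.  The coefficients of a composite of
    polynomials depending on [z] stay rational by [coef_rational_comp]; this
    needs degrees bounded uniformly in [z]. *)

(** * Properties that hold outside a finite set *)

Section AlmostEverywhere.
Variables (R : realType) (D : set (Cplx R)).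
Implicit Types P Q S : R[i] -> Prop.

Lemma almost_everywhere_all P : (forall z, P z) -> almost_everywhere D P.
Proof.
by move=> allP; apply: (sub_finite_set _ (finite_set0 _)) => z [_ /= []].
Qed.

Lemma almost_everywhere2 P Q S : (forall z, P z -> Q z -> S z) ->
  almost_everywhere D P -> almost_everywhere D Q -> almost_everywhere D S.
Proof.
move=> PQS fP fQ.
have fPQ : finite_set ((D `&` [set z | ~ P z]) `|` (D `&` [set z | ~ Q z])).
  by rewrite finite_setU.
apply: sub_finite_set fPQ => z [Dz /= nS].
have [Pz|nP] := pselect (P z); last by left.
by right; split=> //= Qz; apply/nS/PQS.
Qed.

Lemma almost_everywhere_imp P Q : (forall z, P z -> Q z) ->
  almost_everywhere D P -> almost_everywhere D Q.
Proof. by move=> PQ fP; apply: (almost_everywhere2 _ fP fP) => z /PQ. Qed.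

Lemma almost_everywhere_forall (I : finType) (P : I -> R[i] -> Prop) :
  (forall i, almost_everywhere D (P i)) ->
  almost_everywhere D (fun z => forall i, P i z).
Proof.
move=> fP; apply: (@sub_finite_set _ _
  (\bigcup_(i in [set: I]) (D `&` [set z | ~ P i z]))).
  by move=> z [Dz /= /existsNP[i nPi]]; exists i.
by apply: bigcup_finite => // i _; exact: fP.
Qed.

Lemma almost_eq_trans f g h :
  almost_eq D f g -> almost_eq D g h -> almost_eq D f h.
Proof. by apply: almost_everywhere2 => z ->. Qed.

Lemma almost_eq_sym f g : almost_eq D f g -> almost_eq D g f.
Proof. by apply: almost_everywhere_imp => z ->. Qed.

Lemma almost_eq_lift2 (op : R[i] -> R[i] -> R[i]) f f' g g' :
  almost_eq D f f' -> almost_eq D g g' ->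
  almost_eq D (fun z => op (f z) (g z)) (fun z => op (f' z) (g' z)).
Proof. by apply: almost_everywhere2 => z -> ->. Qed.

Lemma almost_everywhere_not_root (p : {poly R[i]}) :
  p != 0 -> almost_everywhere D (fun z => p.[z] != 0).
Proof.
move=> p0; have : finite_set [set z : R[i] | root p z].
  apply: contrapT => /(infinite_set_fset (size p))[B Broot].
  rewrite leqNgt => /negP; apply; apply: max_poly_roots => //.
    by apply/allP => z zB; exact: Broot.
  exact: finmap.fset_uniq.
by apply: sub_finite_set => z [_ /= /negP/negbNE].
Qed.

End AlmostEverywhere.

(** * Values of rational functions *)

Section RationalFunctions.
Variables (R : realType) (D : set (Cplx R)).
Implicit Types (f g : ratfun R) (p q : {poly R[i]}).

(** The value of [f] is computed from a representative that may differ from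
    [p / q] by common factors; cross-multiplication shows that the two values
    agree wherever both denominators are nonzero. *)
Lemma ratval_frac p q : q != 0 ->
  almost_eq D (ratval (tofrac p / tofrac q)) (fun z => p.[z] / q.[z]).
Proof.
move=> q0; rewrite /ratval; set f := tofrac p / tofrac q.
have := frac_numden f; rewrite {1}/f.
have := denom_ratioP (repr f).
move: (\n_(repr f)) (\d_(repr f)) => n d d0 /eqP.
rewrite eqr_div ?tofrac_eq0 // -!tofracM tofrac_eq => /eqP pdnq.
apply: almost_everywhere2 (almost_everywhere_not_root D q0)
  (almost_everywhere_not_root D d0) => z qz dz.
by apply/eqP; rewrite eqr_div // -!hornerM pdnq.
Qed.

Lemma ratval_const (c : R[i]) : almost_eq D (ratval (tofrac c%:P)) (fun=> c).
Proof.
have := @ratval_frac c%:P 1 (oner_neq0 _); rewrite tofrac1 divr1 => /almost_eq_trans.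
by apply; apply: almost_everywhere_all => z; rewrite !hornerE divr1.
Qed.

Lemma ratvalD f g :
  almost_eq D (ratval (f + g)) (fun z => ratval f z + ratval g z).
Proof.
have df := denom_ratioP (repr f); have dg := denom_ratioP (repr g).
rewrite [f in f + _]frac_numden [g in _ + g]frac_numden.
rewrite addf_div ?tofrac_eq0 // -!tofracM -tofracD.
apply: almost_eq_trans (ratval_frac _ (mulf_neq0 df dg)) _.
apply: almost_everywhere2 (almost_everywhere_not_root D df)
  (almost_everywhere_not_root D dg) => z fz gz.
by rewrite /ratval addf_div // !hornerE.
Qed.

Lemma ratvalM f g :
  almost_eq D (ratval (f * g)) (fun z => ratval f z * ratval g z).
Proof.
have df := denom_ratioP (repr f); have dg := denom_ratioP (repr g).
rewrite [f in f * _]frac_numden [g in _ * g]frac_numden.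
rewrite mulf_div -!tofracM.
apply: almost_eq_trans (ratval_frac _ (mulf_neq0 df dg)) _.
apply: almost_everywhere_all => z.
by rewrite /ratval mulf_div !hornerM.
Qed.

(** The case [f = 0] holds because the inverse of [0] is [0] both in the field
    of rational functions and in the complex numbers. *)
Lemma ratvalV f : almost_eq D (ratval f^-1) (fun z => (ratval f z)^-1).
Proof.
have [->|f0] := eqVneq f 0.
  rewrite invr0; have := ratval_const 0; rewrite tofrac0 => v0.
  by apply: almost_everywhere_imp v0 => z ->; rewrite invr0.
have nf : \n_(repr f) != 0.
  by apply: contraNneq f0 => nf; rewrite [f]frac_numden nf tofrac0 mul0r.
rewrite [f in f^-1]frac_numden invf_div.
apply: almost_eq_trans (ratval_frac _ nf) _.
by apply: almost_everywhere_all => z; rewrite /ratval invf_div.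
Qed.

Lemma ratval_sum (I : Type) (s : seq I) (F : I -> ratfun R) :
  almost_eq D (ratval (\sum_(i <- s) F i))
    (fun z => \sum_(i <- s) ratval (F i) z).
Proof.
elim: s => [|i s IHs].
  rewrite big_nil -tofrac0; apply: almost_eq_trans (ratval_const 0) _.
  by apply: almost_everywhere_all => z; rewrite big_nil.
rewrite big_cons; apply: almost_eq_trans (ratvalD _ _) _.
by apply: almost_everywhere_imp IHs => z; rewrite big_cons => ->.
Qed.

End RationalFunctions.

(** * Functions that agree with a rational function *)

Section RationalClosure.
Variables (R : realType) (D : set (Cplx R)).
Implicit Types f g : R[i] -> R[i].

Lemma is_rational_eq f g : almost_eq D f g -> is_rational D g -> is_rational D f.
Proof. by move=> fg [q gq]; exists q; apply: almost_eq_trans fg gq. Qed.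

Lemma is_rational_ext f g : f =1 g -> is_rational D g -> is_rational D f.
Proof.
by move=> fg; apply: is_rational_eq; apply: almost_everywhere_all.
Qed.

Lemma is_rational_ratval (q : ratfun R) : is_rational D (ratval q).
Proof. by exists q; apply: almost_everywhere_all. Qed.

Lemma is_rational_const (c : R[i]) : is_rational D (fun=> c).
Proof. by exists (tofrac c%:P); apply/almost_eq_sym/ratval_const. Qed.

Lemma is_rationalD f g : is_rational D f -> is_rational D g ->
  is_rational D (fun z => f z + g z).
Proof.
move=> [p fp] [q gq]; exists (p + q).
apply: almost_eq_trans (almost_eq_sym (ratvalD _ _ _)).
exact: (almost_eq_lift2 +%R fp gq).
Qed.

Lemma is_rationalM f g : is_rational D f -> is_rational D g ->
  is_rational D (fun z => f z * g z).
Proof.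
move=> [p fp] [q gq]; exists (p * q).
apply: almost_eq_trans (almost_eq_sym (ratvalM _ _ _)).
exact: (almost_eq_lift2 *%R fp gq).
Qed.

Lemma is_rationalV f : is_rational D f -> is_rational D (fun z => (f z)^-1).
Proof.
move=> [p fp]; exists p^-1.
apply: almost_eq_trans (almost_eq_sym (ratvalV _ _)).
by apply: almost_everywhere_imp fp => z ->.
Qed.

Lemma is_rational_sum (I : Type) (s : seq I) (P : pred I)
    (F : I -> R[i] -> R[i]) :
  (forall i, is_rational D (F i)) ->
  is_rational D (fun z => \sum_(i <- s | P i) F i z).
Proof.
move=> ratF; elim: s => [|i s IHs].
  by apply: is_rational_ext (is_rational_const 0) => z; rewrite big_nil.
apply: (@is_rational_ext _
  (fun z => (if P i then F i z else 0) + \sum_(j <- s | P j) F j z)).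
  by move=> z; rewrite big_cons; case: ifP; rewrite ?add0r.
by apply: is_rationalD => //; case: (P i) => //; exact: is_rational_const.
Qed.

Lemma is_rationalX f k : is_rational D f -> is_rational D (fun z => f z ^+ k).
Proof.
move=> ratf; elim: k => [|k IHk]; first exact: is_rational_const.
by apply: is_rational_ext (is_rationalM ratf IHk) => z; rewrite exprS.
Qed.

Lemma is_rational_horner (p : {poly R[i]}) f :
  is_rational D f -> is_rational D (fun z => p.[f z]).
Proof.
move=> ratf; apply: (@is_rational_ext _ (fun z => \sum_(i < size p) p`_i * f z ^+ i)).
  by move=> z; rewrite horner_coef.
apply: is_rational_sum => i; apply: is_rationalM; first exact: is_rational_const.
exact: is_rationalX.
Qed.

(** The composite is a quotient of two polynomial expressions in [f]; this
    covers also a constant [f] with value a pole of [q], where the quotient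
    by zero is the constant [0]. *)
Lemma is_rational_comp (q : ratfun R) f :
  is_rational D f -> is_rational D (fun z => ratval q (f z)).
Proof.
move=> ratf; rewrite /ratval.
apply: is_rationalM; first exact: is_rational_horner.
exact/is_rationalV/is_rational_horner.
Qed.

(** The fibre of [n / d] over [b] consists of roots of [n - b d], which is not
    the zero polynomial unless [r] is the constant [b]. *)
Lemma almost_everywhere_ratval_neq (r : ratfun R) (b : R[i]) :
  (forall c : R[i], r <> tofrac c%:P) ->
  almost_everywhere D (fun z => ratval r z <> b).
Proof.
move=> rnc; set n := \n_(repr r); set d := \d_(repr r).
have d0 : d != 0 := denom_ratioP (repr r).
have nbd0 : n - b *: d != 0.
  rewrite subr_eq0; apply/negP => /eqP nbd; apply: (rnc b).
  by rewrite [r]frac_numden -/n -/d nbd -mul_polyC tofracM mulfK ?tofrac_eq0.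
apply: almost_everywhere2 (almost_everywhere_not_root D d0)
  (almost_everywhere_not_root D nbd0) => z dz nbdz rzb.
move: nbdz; by rewrite -rzb !hornerE /ratval -/n -/d mulfVK ?subrr ?eqxx.
Qed.

(** The exceptional set of [P] pulls back to a finite union of fibres of
    [r], all of which are finite. *)
Lemma almost_everywhere_ratval (U : set (Cplx R)) (r : ratfun R)
    (P : R[i] -> Prop) :
  (forall c : R[i], r <> tofrac c%:P) ->
  almost_everywhere D (fun z => U (ratval r z)) ->
  almost_everywhere U P -> almost_everywhere D (fun z => P (ratval r z)).
Proof.
move=> rnc rDU fP.
have fpre : finite_set (\bigcup_(b in U `&` [set x | ~ P x])
    (D `&` [set z | ~ ratval r z <> b])).
  by apply: bigcup_finite => // b _; exact: almost_everywhere_ratval_neq.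
apply: (almost_everywhere2 (P := fun z => U (ratval r z))
  (Q := fun z => ~ (U (ratval r z) /\ ~ P (ratval r z)))) => //.
  by move=> z Uz nPz; apply: contrapT => ?; apply: nPz.
apply: sub_finite_set fpre => z [Dz /= /contrapT UnP].
by exists (ratval r z) => //; split => //; apply.
Qed.

End RationalClosure.

(** * Linear substitutions *)

Definition linsubst (K : nzRingType) (n : nat) (A : 'M[K]_n) :
    n.-tuple {mpoly K[n]} :=
  [tuple \sum_(k < n) A j k *: 'X_k | j < n].

Lemma linsubst1 (K : nzRingType) (n : nat) (p : {mpoly K[n]}) :
  p \mPo linsubst 1%:M = p.
Proof.
rewrite -[RHS]comp_mpoly_id; congr (_ \mPo _); apply: eq_from_tnth => j.
rewrite !tnth_mktuple (bigD1 j) //= mxE eqxx scale1r big1 ?addr0 // => k /negPf kj.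
by rewrite mxE eq_sym kj scale0r.
Qed.

(** Matrices act on the right by substitution, so that an invertible matrix
    gives an invertible change of variables. *)
Lemma comp_linsubst (K : comNzRingType) (n : nat) (A B : 'M[K]_n)
    (p : {mpoly K[n]}) :
  (p \mPo linsubst A) \mPo linsubst B = p \mPo linsubst (A *m B).
Proof.
rewrite [p \mPo linsubst A]comp_mpolyE [RHS]comp_mpolyE raddf_sum /=.
apply: eq_bigr => mu _; rewrite comp_mpolyZ; congr (_ *: _).
rewrite rmorph_prod; apply: eq_bigr => j _; rewrite rmorphXn; congr (_ ^+ _).
rewrite !tnth_mktuple raddf_sum /=.
under eq_bigr => k _.
  rewrite comp_mpolyZ comp_mpolyXU -tnth_nth tnth_mktuple scaler_sumr.
  over.
rewrite exchange_big /=; apply: eq_bigr => l _; rewrite mxE scaler_suml.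
by apply: eq_bigr => k _; rewrite scalerA.
Qed.

(** * Polynomials with coefficients depending on a complex variable *)

Section Families.
Variables (R : realType) (D : set (Cplx R)) (n : nat).
Implicit Types P Q : R[i] -> {mpoly R[i][n]}.

Definition coef_rational P : Prop :=
  forall mu, is_rational D (fun z => (P z)@_mu).

Definition bounded_msize P : Prop :=
  exists w, forall z, (msize (P z) <= w)%N.

Lemma coef_rational_ext P Q : P =1 Q -> coef_rational Q -> coef_rational P.
Proof.
move=> PQ ratQ mu; by apply: is_rational_ext (ratQ mu) => z; rewrite PQ.
Qed.

Lemma coef_rationalZ f P : is_rational D f -> coef_rational P ->
  coef_rational (fun z => f z *: P z).
Proof.
move=> ratf ratP mu; by apply: is_rational_ext (is_rationalM ratf (ratP mu)) => z; rewrite mcoeffZ.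
Qed.

Lemma coef_rationalM P Q : coef_rational P -> coef_rational Q ->
  coef_rational (fun z => P z * Q z).
Proof.
move=> ratP ratQ mu; apply: (is_rational_ext (g := fun z =>
  \sum_(k : 'X_{1..n < (mdeg mu).+1, (mdeg mu).+1} | mu == (k.1 + k.2)%MM)
     (P z)@_k.1 * (Q z)@_k.2)).
  by move=> z; rewrite mcoeffM.
by apply: is_rational_sum => k; apply: is_rationalM.
Qed.

Lemma coef_rational_const (p : {mpoly R[i][n]}) : coef_rational (fun=> p).
Proof. by move=> mu; exact: is_rational_const. Qed.

Lemma coef_rational_sum (I : Type) (s : seq I) (F : I -> R[i] -> {mpoly R[i][n]}) :
  (forall i, coef_rational (F i)) ->
  coef_rational (fun z => \sum_(i <- s) F i z).
Proof.
move=> ratF mu; apply: (is_rational_ext (g := fun z => \sum_(i <- s) (F i z)@_mu)).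
  by move=> z; rewrite raddf_sum.
by apply: is_rational_sum => i; exact: ratF.
Qed.

Lemma coef_rational_prod (I : Type) (s : seq I) (F : I -> R[i] -> {mpoly R[i][n]}) :
  (forall i, coef_rational (F i)) ->
  coef_rational (fun z => \prod_(i <- s) F i z).
Proof.
move=> ratF; elim: s => [|i s IHs].
  by apply: coef_rational_ext (coef_rational_const 1) => z; rewrite big_nil.
by apply: coef_rational_ext (coef_rationalM (ratF i) IHs) => z; rewrite big_cons.
Qed.

Lemma coef_rationalX P k : coef_rational P -> coef_rational (fun z => P z ^+ k).
Proof.
move=> ratP; elim: k => [|k IHk]; first exact: coef_rational_const.
by apply: coef_rational_ext (coef_rationalM ratP IHk) => z; rewrite exprS.
Qed.

(** The uniform degree bound turns the sum over the monomials of [P z], whose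
    range varies with [z], into a sum over one finite set of monomials. *)
Lemma coef_rational_comp P (t : R[i] -> n.-tuple {mpoly R[i][n]}) :
  bounded_msize P -> coef_rational P ->
  (forall j, coef_rational (fun z => tnth (t z) j)) ->
  coef_rational (fun z => P z \mPo t z).
Proof.
move=> [w Pw] ratP ratt.
apply: (coef_rational_ext (fun z => comp_mpolywE (t z) (Pw z))).
apply: coef_rational_sum => mu; apply: coef_rationalZ => //.
by apply: coef_rational_prod => j; exact: coef_rationalX.
Qed.

Lemma bounded_msizeM P Q : bounded_msize P -> bounded_msize Q ->
  bounded_msize (fun z => P z * Q z).
Proof.
move=> [v Pv] [w Qw]; exists (v + w).+1 => z.
by apply: leq_trans (msizeM_le _ _) _; rewrite ltnS leq_add.
Qed.

Lemma bounded_msize_const (p : {mpoly R[i][n]}) : bounded_msize (fun=> p).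
Proof. by exists (msize p). Qed.

Lemma bounded_msizeZ (f : R[i] -> R[i]) P :
  bounded_msize P -> bounded_msize (fun z => f z *: P z).
Proof. by move=> [w Pw]; exists w => z; exact: leq_trans (msizeZ_le _ _) (Pw z). Qed.

Lemma bounded_msize_sum (I : Type) (s : seq I) (F : I -> R[i] -> {mpoly R[i][n]}) :
  (forall i, bounded_msize (F i)) -> bounded_msize (fun z => \sum_(i <- s) F i z).
Proof.
move=> bF; elim: s => [|i s [w sw]].
  by exists 0%N => z; rewrite big_nil msize0.
have [v iv] := bF i; exists (maxn v w) => z; rewrite big_cons.
apply: leq_trans (mmeasureD_le _ _ _) _.
by rewrite geq_max !leq_max iv sw orbT.
Qed.

Lemma bounded_msize_prod (I : Type) (s : seq I) (F : I -> R[i] -> {mpoly R[i][n]}) :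
  (forall i, bounded_msize (F i)) -> bounded_msize (fun z => \prod_(i <- s) F i z).
Proof.
move=> bF; elim: s => [|i s IHs].
  by exists 1%N => z; rewrite big_nil msize1.
by have [w sw] := bounded_msizeM (bF i) IHs; exists w => z; rewrite big_cons.
Qed.

Lemma bounded_msizeX P k : bounded_msize P -> bounded_msize (fun z => P z ^+ k).
Proof.
move=> bP; elim: k => [|k IHk]; first exact: bounded_msize_const.
by have [w kw] := bounded_msizeM bP IHk; exists w => z; rewrite exprS.
Qed.

Lemma bounded_msize_comp P (t : R[i] -> n.-tuple {mpoly R[i][n]}) :
  bounded_msize P -> (forall j, bounded_msize (fun z => tnth (t z) j)) ->
  bounded_msize (fun z => P z \mPo t z).
Proof.
move=> [w Pw] bt.
suff [v sv] : bounded_msize (fun z => \sum_(mu : 'X_{1..n < w})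
    (P z)@_mu *: \prod_(i < n) tnth (t z) i ^+ mu i).
  by exists v => z; rewrite (comp_mpolywE (t z) (Pw z)).
apply: bounded_msize_sum => mu; apply: bounded_msizeZ.
by apply: bounded_msize_prod => j; exact: bounded_msizeX.
Qed.

Definition ratval_mx (A : 'M[ratfun R]_n) (z : R[i]) : 'M[R[i]]_n :=
  map_mx (fun q => ratval q z) A.

Lemma coef_rational_linsubst (A : 'M[ratfun R]_n) P :
  bounded_msize P -> coef_rational P ->
  coef_rational (fun z => P z \mPo linsubst (ratval_mx A z)).
Proof.
move=> bP ratP; apply: coef_rational_comp => // j.
apply: (@coef_rational_ext _ (fun z => \sum_(k < n) ratval (A j k) z *: 'X_k)).
  by move=> z; rewrite tnth_mktuple; apply: eq_bigr => k _; rewrite mxE.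
apply: coef_rational_sum => k; apply: coef_rationalZ (coef_rational_const _).
exact: is_rational_ratval.
Qed.

Lemma bounded_msize_linsubst (A : R[i] -> 'M[R[i]]_n) P :
  bounded_msize P -> bounded_msize (fun z => P z \mPo linsubst (A z)).
Proof.
move=> bP; apply: bounded_msize_comp => // j.
have [w Aw] : bounded_msize (fun z => \sum_(k < n) A z j k *: 'X_k).
  by apply: bounded_msize_sum => k; apply/bounded_msizeZ/bounded_msize_const.
by exists w => z; rewrite tnth_mktuple.
Qed.

(** Evaluation is not a ring morphism at poles and at common zeros of
    numerator and denominator; each entry of the product involves finitely
    many sums and products, hence finitely many exceptional points. *)
Lemma ratval_mx_mul1 (A B : 'M[ratfun R]_n) : A *m B = 1%:M ->
  almost_everywhere D (fun z => ratval_mx A z *m ratval_mx B z = 1%:M).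
Proof.
move=> AB1; have entry (ij : 'I_n * 'I_n) :
    almost_everywhere D (fun z =>
      (ratval_mx A z *m ratval_mx B z) ij.1 ij.2 = (1%:M : 'M[R[i]]_n) ij.1 ij.2).
  case: ij => j l /=.
  have c_const : almost_eq D (ratval ((1%:M : 'M[ratfun R]_n) j l))
                 (fun=> (1%:M : 'M[R[i]]_n) j l).
    rewrite !mxE; have := @ratval_const R D (j == l)%:R.
    by case: (j == l); rewrite /= ?tofrac1 ?tofrac0.
  rewrite -AB1 mxE in c_const.
  have := almost_eq_sym (ratval_sum D (index_enum 'I_n) (fun k => A j k * B k l)).
  move=> /almost_eq_trans/(_ c_const) sum_const.
  have mulP : almost_everywhere D (fun z => forall k,
      ratval (A j k * B k l) z = ratval (A j k) z * ratval (B k l) z).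
    by apply: almost_everywhere_forall => k; exact: ratvalM.
  apply: almost_everywhere2 sum_const mulP => z <- mulz.
  by rewrite mxE; apply: eq_bigr => k _; rewrite mulz !mxE.
apply: almost_everywhere_imp (almost_everywhere_forall entry) => z entryz.
by apply/matrixP => j l; exact: (entryz (j, l)).
Qed.

End Families.

(** * The matrix of the chain rule *)

Section ChainRule.
Variable K : fieldType.
Implicit Types (p q : {poly K}) (r : {fraction {poly K}}).

Lemma fracderiv0 : fracderiv (0 : {fraction {poly K}}) = 0.
Proof.
have := fracderivE 0 (oner_neq0 {poly K}).
by rewrite tofrac0 mul0r deriv0 !mul0r subr0 tofrac0 mul0r.
Qed.

(** Each application of d/dx raises the order of a differential expression by
    one, and the leading coefficient gets multiplied by [1 / r']. *)
Lemma coef_chain_rule_gt r j k : (j < k)%N -> (chain_rule r j)`_k = 0.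
Proof.
elim: j k => [|j IHj] [|k] //; first by rewrite coef1.
rewrite ltnS => jk; rewrite coefZ coefD coefMX /= IHj // addr0.
by rewrite coef_map_id0 ?fracderiv0 // IHj ?fracderiv0 ?mulr0 // ltnW.
Qed.

Lemma coef_chain_rule_diag r j : (chain_rule r j)`_j = (fracderiv r)^-1 ^+ j.
Proof.
elim: j => [|j IHj]; first by rewrite coef1.
rewrite coefZ coefD coefMX /= coef_map_id0 ?fracderiv0 //.
by rewrite coef_chain_rule_gt // fracderiv0 add0r -/(chain_rule r j) IHj exprS.
Qed.

Definition chain_mx r s : 'M[{fraction {poly K}}]_s :=
  \matrix_(j, k) (chain_rule r j)`_k.

Lemma chain_mx_unit r s : fracderiv r != 0 -> chain_mx r s \in unitmx.
Proof.
move=> r'0; rewrite unitmxE det_trig.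
  rewrite unitfE; apply/prodf_neq0 => j _.
  by rewrite mxE coef_chain_rule_diag expf_neq0 ?invr_eq0.
by apply/is_trig_mxP => j k jk; rewrite mxE coef_chain_rule_gt.
Qed.

End ChainRule.

Lemma deriv_eq0_polyC (K : numFieldType) (p : {poly K}) :
  p^`() = 0 -> p = (p`_0)%:P.
Proof.
move=> p'0; apply/polyP => -[|i]; rewrite coefC //=.
have := congr1 (fun q : {poly K} => q`_i) p'0; rewrite coef_deriv coef0 => /eqP.
by rewrite mulrn_eq0 => /eqP.
Qed.

(** For [r = p / q] in lowest terms, [r' = 0] means [p' q = p q'], so [q]
    divides [q'] and has to be constant for degree reasons; then so is [p]. *)
Lemma fracderiv_eq0 (K : numFieldType) (r : {fraction {poly K}}) :
  fracderiv r = 0 -> exists c, r = tofrac c%:P.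
Proof.
have d0 := denom_ratioP (repr r).
set g := gcdp \n_(repr r) \d_(repr r).
set p := \n_(repr r) %/ g; set q := \d_(repr r) %/ g.
have g0 : g != 0 by rewrite gcdp_eq0 negb_and d0 orbT.
have dE : \d_(repr r) = q * g by rewrite divpK ?dvdp_gcdr.
have nE : \n_(repr r) = p * g by rewrite divpK ?dvdp_gcdl.
have q0 : q != 0 by apply: contraNneq d0 => q0; rewrite dE q0 mul0r.
have cpq : coprimep q p by rewrite coprimep_sym coprimep_div_gcd ?d0 ?orbT.
have -> : r = tofrac p / tofrac q.
  by rewrite {1}[r]frac_numden nE dE !tofracM -mulf_div divff ?mulr1 ?tofrac_eq0.
rewrite fracderivE // => /eqP; rewrite mulf_eq0 invr_eq0 !tofrac_eq0.
rewrite expf_eq0 /= (negPf q0) orbF subr_eq0 => /eqP pq.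
have q'0 : q^`() = 0.
  have : q %| q^`() by rewrite -(Gauss_dvdpr _ cpq) -pq dvdp_mull.
  move=> qq'; apply/eqP; apply: contraTT qq' => q'0.
  by rewrite gtNdvdp // lt_size_deriv.
have p'0 : p^`() = 0.
  by apply/eqP; move/eqP: pq; rewrite q'0 mulr0 mulf_eq0 (negPf q0) orbF.
exists (p`_0 / q`_0); rewrite (deriv_eq0_polyC p'0) (deriv_eq0_polyC q'0) !coefC /=.
have cq0 : q`_0 != 0.
  by apply: contraNneq q0 => cq0; rewrite (deriv_eq0_polyC q'0) cq0.
apply: (canLR (mulfK _)); first by rewrite tofrac_eq0 polyC_eq0.
by rewrite -tofracM -polyCM mulfVK.
Qed.

(** * The transformed equation *)

Lemma transformedE (R : realType) (L : fieldExtType (ratfun R))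
    (ev : L -> R[i] -> R[i]) (r : ratfun R) (s : nat) (F : {mpoly L[s.+1]})
    (z : R[i]) :
  transformed ev r F z =
  map_mpoly (fun a : L => ev a (ratval r z)) F
    \mPo linsubst (ratval_mx (chain_mx r s.+1) z).
Proof.
have -> : linsubst (ratval_mx (chain_mx r s.+1) z) =
    [tuple \sum_(k < s.+1) ratval (chain_rule r j)`_k z *: 'X_k | j < s.+1].
  apply: eq_from_tnth => j; rewrite !tnth_mktuple.
  by apply: eq_bigr => k _; rewrite [ratval_mx _ _ _ _]mxE [chain_mx _ _ _ _]mxE.
by [].
Qed.

(** Evaluation of [ev] at a single point need not be additive, nor send [0] to
    [0], so coefficients outside the support have to be treated apart. *)
Lemma mcoeff_map_mpoly_fun (K S : nzRingType) (n : nat) (f : K -> S)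
    (p : {mpoly K[n]}) (mu : 'X_{1..n}) :
  (map_mpoly f p)@_mu = if mu \in msupp p then f p@_mu else 0.
Proof.
rewrite /map_mpoly /mmap raddf_sum /=.
have summand nu : (mpolyC n (f p@_nu) * mmap1 (fun i => 'X_i) nu)@_mu
    = if nu == mu then f p@_nu else 0.
  by rewrite mmap1_id mcoeffCM mcoeffX; case: eqP; rewrite ?mulr1 ?mulr0.
under eq_bigr do rewrite summand.
case: ifPn => muF; last first.
  by rewrite big_seq big1 // => nu nuF; case: eqP muF => // <-; rewrite nuF.
rewrite (bigD1_seq mu) ?msupp_uniq //= eqxx big1 ?addr0 // => nu /negPf -> //.
Qed.

Lemma bounded_msize_map_mpoly (R : realType) (K : nzRingType) (n : nat)
    (f : K -> R[i] -> R[i]) (p : {mpoly K[n]}) (t : R[i] -> R[i]) :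
  bounded_msize (fun z => map_mpoly (fun a => f a (t z)) p).
Proof.
rewrite /map_mpoly /mmap; apply: bounded_msize_sum => mu.
have [w muw] := bounded_msizeZ (fun z => f p@_mu (t z))
  (bounded_msize_const (mmap1 (fun i => 'X_i : {mpoly R[i][n]}) mu)).
by exists w => z; rewrite /= mul_mpolyC.
Qed.

Theorem theorem3p3 (R : realType) (L : fieldExtType (ratfun R))
    (m : nat) (delta : m.-tuple L) (e : m.-tuple nat)
    (tower : radical_tower delta e)
    (U : set (Cplx R)) (domU : complex_domain U)
    (ev : L -> R[i] -> R[i]) (branches : branch_choice U ev)
    (s : nat) (F : {mpoly L[s.+1]})
    (r : ratfun R) (r_nonconstant : forall c : R[i], r <> tofrac c%:P)
    (V : set (Cplx R)) (domV : complex_domain V)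
    (rVU : almost_everywhere V (fun z => U (ratval r z)))
    (l : nat) (a : l.-tuple L)
    (a_coeffs : perm_eq a
       [seq F@_mu | mu <- msupp F & F@_mu \notin 1%VS]) :
  (forall nu : 'X_{1..s.+1},
      is_rational V (fun z => (transformed ev r F z)@_nu))
  <-> (forall i : 'I_l,
      is_rational V (fun z => ev (tnth a i) (ratval r z))).
Proof.
pose P z := map_mpoly (fun a : L => ev a (ratval r z)) F.
pose M := chain_mx r s.+1.
have bP : bounded_msize P by exact: bounded_msize_map_mpoly.
have aP c : c \in a <->
    exists2 mu, mu \in msupp F & c = F@_mu /\ F@_mu \notin 1%VS.
  rewrite (perm_mem a_coeffs); split.
    by move=> /mapP[mu]; rewrite mem_filter => /andP[Fmu muF ->]; exists mu.
  move=> [mu muF [-> Fmu]].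
  by apply/mapP; exists mu; rewrite // mem_filter Fmu.
suff transformedP :
    (forall nu, is_rational V (fun z => (transformed ev r F z)@_nu))
    <-> coef_rational V P.
  rewrite transformedP; split=> [ratP i|rat_a mu].
    have /aP[mu muF [-> _]] := mem_tnth i a.
    by apply: is_rational_ext (ratP mu) => z; rewrite mcoeff_map_mpoly_fun muF.
  have [muF|muF] := boolP (mu \in msupp F); last first.
    apply: is_rational_ext (is_rational_const V 0) => z.
    by rewrite mcoeff_map_mpoly_fun (negPf muF).
  apply: (is_rational_ext (g := fun z => ev F@_mu (ratval r z))).
    by move=> z; rewrite mcoeff_map_mpoly_fun muF.
  have [/vlineP[f ->]|Fmu] := boolP (F@_mu \in 1%VS).
    have [_ evK _ _] := branches.
    apply: is_rational_eq (is_rational_comp f (is_rational_ratval V r)).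
    exact: almost_everywhere_ratval (evK f).
  have /tnthP[i ->] : F@_mu \in a by apply/aP; exists mu.
  exact: rat_a.
(* Rationality of the coefficients passes through substitutions that are
   rational in [z]: by [M] in one direction, by its inverse in the other. *)
have TE : transformed ev r F =1 fun z => P z \mPo linsubst (ratval_mx M z).
  by move=> z; exact: transformedE.
split=> [ratT|ratP]; last first.
  exact: coef_rational_ext TE (coef_rational_linsubst _ bP ratP).
have r'0 : fracderiv r != 0.
  by apply/eqP => /fracderiv_eq0[c]; exact: r_nonconstant.
have ratQ : coef_rational V
    (fun z => (P z \mPo linsubst (ratval_mx M z)) \mPo linsubst (ratval_mx (invmx M) z)).
  apply: coef_rational_linsubst; first exact: bounded_msize_linsubst.
  by apply: coef_rational_ext ratT => z; rewrite TE.
have Minv := ratval_mx_mul1 V (mulmxV (chain_mx_unit s.+1 r'0)).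
move=> mu; apply: is_rational_eq (ratQ mu).
apply: almost_everywhere_imp Minv => z MN1.
by rewrite comp_linsubst MN1 linsubst1.
Qed.
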